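(* Let $d\geq 3$ and let $\pi_1,\dots,\pi_d$ be planes in $\mathbb P^4$ such that the union of any two of them is nondegenerate. Let $\Pi_1,\Pi_2$ be distinct planes in $\mathbb P^4$ such that $\pi_i\cap\Pi_j=\ell_{ij}$ is a line for all $1\le i\le d$ and $j=1,2$. Assume that the lines $\ell_{ij}$ are distinct. Then the planes $\pi_1,\dots,\pi_d$ have a point in common.
   Context: We work over $\mathbb C$. A subset of $\mathbb P^4$ is nondegenerate if it is not contained in a hyperplane. *)

(* Defs.v *)
From HB Require Import structures.
From mathcomp Require Import all_boot all_order all_algebra.
From mathcomp Require Import boolp classical_sets reals.
From mathcomp Require Import complex.

Set Implicit Arguments.
Unset Strict Implicit.
Unset Printing Implicit Defensive.

Import GRing.Theory.

Local Open Scope classical_set_scope.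

(* A point of the projective n-space over K is a 1-dimensional linear subspace
   of K^(n+1). *)
Definition projective_space (K : fieldType) (n : nat) :=
  {p : {vspace 'rV[K]_n.+1} | \dim p == 1%N}.

Definition projectivization (K : fieldType) (n : nat)
    (W : {vspace 'rV[K]_n.+1}) : set (projective_space K n) :=
  [set p | (val p <= W)%VS].

(* k is the projective dimension, so the underlying vector subspace has
   dimension k + 1. *)
Definition linear_subspace (K : fieldType) (n k : nat)
    (S : set (projective_space K n)) : Prop :=
  exists2 W : {vspace 'rV[K]_n.+1}, \dim W = k.+1 & S = projectivization W.

Definition is_line (K : fieldType) (n : nat)
  (S : set (projective_space K n)) : Prop := linear_subspace 1 S.

Definition is_plane (K : fieldType) (n : nat)
  (S : set (projective_space K n)) : Prop := linear_subspace 2 S.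

(* The form "linear_subspace n.-1 S" would be wrong for n = 0. *)
Definition is_hyperplane (K : fieldType) (n : nat)
    (S : set (projective_space K n)) : Prop :=
  exists2 W : {vspace 'rV[K]_n.+1}, \dim W = n & S = projectivization W.

Definition nondegenerate_set (K : fieldType) (n : nat)
    (S : set (projective_space K n)) : Prop :=
  forall H : set (projective_space K n), is_hyperplane H -> ~ (S `<=` H).

(* Main.v *)
Require Import Defs.
From HB Require Import structures.
From mathcomp Require Import all_boot all_order all_algebra.
From mathcomp Require Import boolp classical_sets reals.
From mathcomp Require Import complex.

(** The common point is the point in which [Pi_1] and [Pi_2] meet.

    Pass to linear subspaces of K^5: let [V_i] and [W_j] be the 3-dimensional
    spaces under [pi_i] and [Pi_j].  The spaces [V_i :&: W_1] and
    [V_i :&: W_2] are distinct of dimension 2, so they span the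
    3-dimensional [V_i] and meet in dimension 1 ([sum_distinct_hyperplanes]).
    Hence every [V_i] lies in [W_1 + W_2] and contains a 1-dimensional
    subspace of [W_1 :&: W_2].  Two of the [V_i] already span K^5
    ([nondegenerate_setU_fullv]), so [W_1 + W_2] is K^5, and
    [W_1 :&: W_2] has dimension 3 + 3 - 5 = 1.  The subspace of it found in
    [V_i] is therefore all of [W_1 :&: W_2], whatever [i] is. *)

Set Implicit Arguments.
Unset Strict Implicit.
Unset Printing Implicit Defensive.

Import GRing.Theory.

Local Open Scope classical_set_scope.
Local Open Scope complex_scope.

Section VectorSpaces.
Variables (K : fieldType) (vT : vectType K).
Implicit Types U V W H : {vspace vT}.

(** Remove one vector [v] from a complement of [U] and add what is left of the
    complement to [U]. *)
Lemma hyperplane_above U : U != fullv ->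
  exists2 H : {vspace vT}, (\dim H).+1 = \dim {:vT} & (U <= H)%VS.
Proof.
move=> nfU; set v := vpick (U^C)%VS.
have v_neq0 : v != 0%R.
  rewrite vpick0; apply: contraNneq nfU => UC0.
  by rewrite -(addv_complf U) UC0 addv0.
have capv1 : (U^C :&: <[v]> = <[v]>)%VS.
  by apply/capv_idPr; rewrite -memvE memv_pick.
exists (U + (U^C :\: <[v]>))%VS; last exact: addvSl.
have disj : (U :&: (U^C :\: <[v]>) = 0)%VS.
  by apply/eqP; rewrite -subv0 -(capv_compl U) capvS ?diffvSl.
rewrite dimv_disjoint_sum // -addnS -(addv_complf U).
rewrite dimv_disjoint_sum ?capv_compl //; congr (_ + _)%N.
by rewrite -(dimv_cap_compl (U^C)%VS <[v]>%VS) capv1 dim_vline v_neq0.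
Qed.

(** Otherwise the sum would have the dimension of both [U1] and [U2], and so be
    equal to each. *)
Lemma sum_distinct_hyperplanes V U1 U2 n :
    (U1 <= V)%VS -> (U2 <= V)%VS -> U1 != U2 ->
    \dim U1 = n -> \dim U2 = n -> \dim V = n.+1 ->
  (U1 + U2 = V)%VS.
Proof.
move=> sU1V sU2V neqU dU1 dU2 dV.
have sUV : (U1 + U2 <= V)%VS by rewrite subv_add sU1V.
apply/eqP; rewrite eqEdim sUV dV -dU1 ltnNge; apply: contra neqU => dU.
have eU1 : U1 = (U1 + U2)%VS by apply/eqP; rewrite eqEdim addvSl.
have eU2 : U2 = (U1 + U2)%VS by apply/eqP; rewrite eqEdim addvSr dU2 -dU1.
by apply/eqP; exact: etrans eU1 (esym eU2).
Qed.

End VectorSpaces.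

Section ProjectiveSpace.
Variables (K : fieldType) (n : nat).
Implicit Types U V W : {vspace 'rV[K]_n.+1}.

Lemma projectivizationI V W :
  projectivization V `&` projectivization W = projectivization (V :&: W)%VS.
Proof.
by apply/seteqP; split => p /=; rewrite /projectivization /= subv_cap => /andP.
Qed.

(** A nonzero vector of [V] spans a point, so the points of [V] determine its
    vectors. *)
Lemma projectivization_subset V W :
  projectivization V `<=` projectivization W -> (V <= W)%VS.
Proof.
move=> sVW; apply/subvP => v vV.
have [-> | v_neq0] := eqVneq v 0%R; first exact: mem0v.
have dv : \dim <[v]>%VS == 1 by rewrite dim_vline v_neq0.
by have := sVW (exist _ <[v]>%VS dv); rewrite /projectivization /= -!memvE; apply.
Qed.

Lemma projectivization_inj : injective (@projectivization K n).
Proof.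
move=> V W eVW; apply: subv_anti.
by apply/andP; split; apply: projectivization_subset; rewrite eVW.
Qed.

Lemma nondegenerate_setU_fullv V W :
    nondegenerate_set (projectivization V `|` projectivization W) ->
  (V + W = fullv)%VS.
Proof.
move=> nd; apply: contrapT => /eqP /hyperplane_above[H dH].
rewrite subv_add => /andP[sVH sWH]; apply: (nd (projectivization H)).
  by exists H => //; move: dH; rewrite dimvf /dim /= mul1n => -[].
by move=> p [] /subv_trans; apply.
Qed.

End ProjectiveSpace.

(** The linear algebra behind the theorem.  Each [V i] is spanned by its
    intersections with [W1] and [W2], so [W1 + W2] contains [V i0 + V i1] and
    is the whole space; Grassmann's formula, applied to [W1] and [W2] and to
    the two intersections inside [V i], gives two 1-dimensional spaces, one
    contained in the other. *)
Lemma common_line (K : fieldType) (vT : vectType K) (I : Type)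
    (V : I -> {vspace vT}) (W1 W2 : {vspace vT}) (i0 i1 : I) :
    \dim {:vT} = 5 -> (V i0 + V i1 = fullv)%VS ->
    (forall i, \dim (V i) = 3) -> \dim W1 = 3 -> \dim W2 = 3 ->
    (forall i, \dim (V i :&: W1) = 2) -> (forall i, \dim (V i :&: W2) = 2) ->
    (forall i, (V i :&: W1)%VS != (V i :&: W2)%VS) ->
  \dim (W1 :&: W2) = 1 /\ forall i, (W1 :&: W2 <= V i)%VS.
Proof.
move=> dT spanV dV dW1 dW2 dL1 dL2 neqL.
have sumL i : (V i :&: W1 + V i :&: W2 = V i)%VS.
  by apply: sum_distinct_hyperplanes (dL1 i) (dL2 i) (dV i); rewrite ?capvSl.
have sVW i : (V i <= W1 + W2)%VS by rewrite -(sumL i) addvS ?capvSr.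
have sumW : (W1 + W2 = fullv)%VS.
  by apply: subv_anti; rewrite subvf -spanV subv_add !sVW.
have dW : \dim (W1 :&: W2) = 1.
  by have := dimv_sum_cap W1 W2; rewrite sumW dT dW1 dW2 => -[].
split=> // i; set L := (V i :&: W1 :&: (V i :&: W2))%VS.
have dL : \dim L = 1.
  have := dimv_sum_cap (V i :&: W1)%VS (V i :&: W2)%VS.
  by rewrite sumL dV dL1 dL2 => -[].
have sLW : (L <= W1 :&: W2)%VS by rewrite capvS ?capvSr.
suff /eqP <- : L == (W1 :&: W2)%VS.
  exact: subv_trans (capvSl _ _) (capvSl _ _).
by rewrite eqEdim sLW dL dW.
Qed.

Theorem proposition2p17 (R : realType) (d : nat) (hd : (3 <= d)%N)
  (pi : 'I_d -> set (projective_space R[i] 4))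
  (Pi : 'I_2 -> set (projective_space R[i] 4))
  (hpi : forall i : 'I_d, is_plane (pi i))
  (hnondeg : forall i i' : 'I_d, i <> i' -> nondegenerate_set (pi i `|` pi i'))
  (hPi : forall j : 'I_2, is_plane (Pi j))
  (hPi_distinct : forall j j' : 'I_2, j <> j' -> Pi j <> Pi j')
  (hl : forall (i : 'I_d) (j : 'I_2), is_line (pi i `&` Pi j))
  (hl_distinct : forall (i i' : 'I_d) (j j' : 'I_2),
     (i, j) <> (i', j') -> pi i `&` Pi j <> pi i' `&` Pi j') :
  exists p : projective_space R[i] 4, forall i : 'I_d, pi i p.
Proof.
have /choice[V hV] i : exists V, \dim V = 3 /\ pi i = projectivization V.
  by have [V] := hpi i; exists V.
have /choice[W hW] j : exists W, \dim W = 3 /\ Pi j = projectivization W.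
  by have [W] := hPi j; exists W.
have capE i j : pi i `&` Pi j = projectivization (V i :&: W j)%VS.
  by rewrite (hV i).2 (hW j).2 projectivizationI.
have dL i j : \dim (V i :&: W j) = 2.
  by have [U dU] := hl i j; rewrite capE => /projectivization_inj ->.
have neqL i : (V i :&: W ord0 != V i :&: W ord_max)%VS.
  apply/eqP => eqL; apply: (hl_distinct i i ord0 ord_max); first by case.
  by rewrite !capE eqL.
pose i0 : 'I_d := Ordinal (leq_trans (isT : 0 < 3) hd).
pose i1 : 'I_d := Ordinal (leq_trans (isT : 1 < 3) hd).
have spanV : (V i0 + V i1 = fullv)%VS.
  apply: nondegenerate_setU_fullv.
  by rewrite -(hV i0).2 -(hV i1).2; apply: hnondeg => -[].
have dT : \dim {: 'rV[R[i]]_5} = 5 by rewrite dimvf /dim /= mul1n.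
have [dP sPV] := common_line dT spanV (fun i => (hV i).1) (hW ord0).1
  (hW ord_max).1 (fun i => dL i ord0) (fun i => dL i ord_max) neqL.
exists (exist _ (W ord0 :&: W ord_max)%VS (introT eqP dP)) => i.
by rewrite (hV i).2; exact: sPV.
Qed.
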